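(* Let $\rho_1,\rho_2\in\mathbb{C}$ and let $a_{nm}$, $b_{nm}$ ($n,m\in\{1,2\}$) be complex numbers such that $A=a_{11}a_{22}-a_{12}a_{21}\neq 0$ and $$b_{11}=\frac{a_{22}}{A},\quad b_{12}=-\frac{a_{12}}{A},\quad b_{21}=-\frac{a_{21}}{A},\quad b_{22}=\frac{a_{11}}{A};$$ equivalently, with $B=b_{11}b_{22}-b_{12}b_{21}=A^{-1}$, $$a_{11}=\frac{b_{22}}{B},\quad a_{12}=-\frac{b_{12}}{B},\quad a_{21}=-\frac{b_{21}}{B},\quad a_{22}=\frac{b_{11}}{B}.$$ (Thus $\rho_1,\rho_2$ together with either the four $a_{nm}$ or the four $b_{nm}$ may be assigned arbitrarily, subject to $A\ne0$ or, equivalently, $B\neq 0$.) Define, for $n=1,2$, $$c_{n1}=b_{n1}a_{11}^2+b_{n2}\left[\rho_1a_{11}^2+(\rho_2a_{11}+a_{21})a_{21}\right],$$ $$c_{n2}=2b_{n1}a_{11}a_{12}+b_{n2}\left[2\rho_1a_{11}a_{12}+\rho_2(a_{11}a_{22}+a_{12}a_{21})+2a_{21}a_{22}\right],$$ $$c_{n3}=b_{n1}a_{12}^2+b_{n2}\left[\rho_1a_{12}^2+(\rho_2a_{12}+a_{22})a_{22}\right].$$ Then the initial-value problem for the system $$\dot x_n(t)=c_{n1}[x_1(t)]^2+c_{n2}\,x_1(t)x_2(t)+c_{n3}[x_2(t)]^2,\qquad n=1,2,$$ is explicitly solvable for generic initial data $x_1(0),x_2(0)$, as follows. The solution is $$x_1(t)=b_{11}y_1(t)+b_{12}y_2(t),\qquad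 x_2(t)=b_{21}y_1(t)+b_{22}y_2(t),$$ or, equivalently, $y_1(t)=a_{11}x_1(t)+a_{12}x_2(t)$ and $y_2(t)=a_{21}x_1(t)+a_{22}x_2(t)$, where $(y_1,y_2)$ is the solution of $$\dot y_1=y_1^2,\qquad \dot y_2=\rho_1y_1^2+\rho_2y_1y_2+y_2^2$$ with initial data $y_1(0)=a_{11}x_1(0)+a_{12}x_2(0)$, $y_2(0)=a_{21}x_1(0)+a_{22}x_2(0)$. Explicitly, setting $\Delta=\sqrt{(1-\rho_2)^2-4\rho_1}$ and $u_\pm=(1-\rho_2\pm\Delta)/2$, if $\Delta\neq0$ and $y_1(0)\neq 0$, then $$y_1(t)=\frac{y_1(0)}{1-y_1(0)t},\qquad y_2(t)=\frac{y_1(0)}{1-y_1(0)t}\,u(t),\qquad u(0)=\frac{y_2(0)}{y_1(0)},$$ $$u(t)=\frac{u_+\,[u(0)-u_-]-u_-\,[u(0)-u_+]\,[1-y_1(0)t]^{-\Delta}}{u(0)-u_- -[u(0)-u_+]\,[1-y_1(0)t]^{-\Delta}} .$$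
   Context: Dots denote differentiation with respect to $t$; all parameters and dependent variables may be complex. ''Explicitly solvable'' means that the solution of the initial-value problem is exhibited as an elementary function of $t$, with parameters given by explicit elementary formulas; here this is the content of the displayed solution. ''Generic initial data'' means $y_1(0)=a_{11}x_1(0)+a_{12}x_2(0)\neq 0$. The formulas hold on any interval of $t$ containing $0$ on which the denominators appearing in them do not vanish; the power $[1-y_1(0)t]^{-\Delta}$ denotes the continuous branch along that interval that equals $1$ at $t=0$. *)

(* Defs.v *)
From Stdlib Require Import Reals.
From Coquelicot Require Import Coquelicot.

Open Scope C_scope.

(* Any interval: open, closed or half-open, bounded or not. *)
Definition is_interval (I : R -> Prop) : Prop :=
  forall s r t : R, I s -> I r -> (s <= t <= r)%R -> I t.

(* Derivative of a complex-valued function of a real variable, relative to I: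
   [is_derive] with [locally t] replaced by [within I (locally t)], hence
   one-sided at an end point of I that belongs to I and two-sided inside I. *)
Definition is_derive_within (I : R -> Prop) (f : R -> C) (t : R) (l : C) : Prop :=
  filterdiff (K := R_AbsRing) (U := R_NormedModule) (V := C_R_NormedModule)
    f (within I (locally t))
    (fun h : R => scal (K := R_AbsRing) (V := C_R_NormedModule) h l).

Definition solves_ivp (I : R -> Prop) (F1 F2 : C -> C -> C) (z10 z20 : C)
    (z1 z2 : R -> C) : Prop :=
  z1 0%R = z10 /\ z2 0%R = z20 /\
  forall t : R, I t ->
    is_derive_within I z1 t (F1 (z1 t) (z2 t)) /\
    is_derive_within I z2 t (F2 (z1 t) (z2 t)).

Definition Cexp (z : C) : C :=
  ((exp (Re z) * cos (Im z))%R, (exp (Re z) * sin (Im z))%R).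

(* On I, p is the continuous branch of the power f^alpha with p(0) = 1:
   p = exp (alpha L) for a continuous logarithm L of f along I.  The values
   of p outside I are irrelevant. *)
Definition is_power_branch (I : R -> Prop) (f : R -> C) (alpha : C)
    (p : R -> C) : Prop :=
  p 0%R = 1 /\
  exists L : R -> C,
    continuous_on I L /\
    forall t : R, I t -> Cexp (L t) = f t /\ p t = Cexp (alpha * L t).

(* The q's are the entries of the inverse of the matrix of the p's. *)
Definition inverse_entries (p11 p12 p21 p22 q11 q12 q21 q22 : C) : Prop :=
  let P := p11 * p22 - p12 * p21 in
  P <> 0 /\
  q11 = p22 / P /\ q12 = - (p12 / P) /\ q21 = - (p21 / P) /\ q22 = p11 / P.

(* Main.v *)
Require Import Defs.
From Stdlib Require Import Reals Lra.
From Coquelicot Require Import Coquelicot.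

(** The coefficients [c] are exactly those for which the quadratic field in [x]
    is [b] applied to the field in [y] evaluated at [a x]; since [a] and [b] are
    inverse matrices, the linear change of variables carries solutions to
    solutions in both directions ([solves_ivp_linear]).  Everything else
    concerns the triangular system in [y].

    With [d t = 1 - y1(0) t], the first component is [y1 = y1(0) / d].  The
    ansatz [y2 = y1 u] turns the second equation into
    [u' = y1 (u - up) (u - um)], where [up] and [um] are the roots of
    [u ^ 2 + (rho2 - 1) u + rho1].  This separates: [(u - up) / (u - um)] is
    proportional to a function [p] with [p' = Delta y1 p], that is, to
    [d ^ (- Delta)].  Solving for [u] gives the formula, which
    [riccati_system_formula] verifies by differentiation.

    A power branch comes from a logarithm [L] that is only assumed continuous.
    Differentiating [p = exp (- Delta L)] therefore needs
    [is_derive_within_log]: a continuous logarithm of a differentiable function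
    is differentiable, because [(exp z - 1) / z] tends to [1] at [0].  Branches
    exist because [d' / d] has a primitive ([continuous_log_exists],
    [power_branch_line_exists]).

    The solution is unique because the difference of two solutions of the
    triangular system solves, one component after the other, a homogeneous
    linear equation with continuous coefficient.  An integrating factor shows
    that such an equation has only the zero solution with initial value [0]
    ([linear_ode_zero], [riccati_system_unique]).

    Derivatives are taken relative to an interval that may contain its end
    points, so the rules of calculus are derived for this notion, through
    Caratheodory's slope functions ([is_derive_within_slope]). *)

Open Scope C_scope.

(** * Limits of complex-valued functions *)

Lemma lim_C_eps {T : Type} {F : (T -> Prop) -> Prop} {FF : Filter F}
    (f : T -> C) (l : C) :
  filterlim f F (locally l) <->
  forall eps : posreal, F (fun s => (Cmod (f s - l) < eps)%R).
Proof.
  exact (filterlim_locally_ball_norm (U := C_NormedModule) f l).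
Qed.

Lemma lim_C_plus {T : Type} {F : (T -> Prop) -> Prop} {FF : Filter F}
    (f g : T -> C) (a b : C) :
  filterlim f F (locally a) -> filterlim g F (locally b) ->
  filterlim (fun s => f s + g s) F (locally (a + b)).
Proof.
  intros Hf Hg.
  exact (filterlim_comp_2 f g Cplus Hf Hg
           (filterlim_plus (V := C_R_NormedModule) a b)).
Qed.

Lemma lim_C_mult {T : Type} {F : (T -> Prop) -> Prop} {FF : Filter F}
    (f g : T -> C) (a b : C) :
  filterlim f F (locally a) -> filterlim g F (locally b) ->
  filterlim (fun s => f s * g s) F (locally (a * b)).
Proof.
  intros Hf Hg.
  assert (Hf' : filterlim f F (locally (T := AbsRing_UniformSpace C_AbsRing) a))
    by (intros P HP; apply Hf, locally_C, HP).
  exact (filterlim_comp_2 f g Cmult Hf' Hg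
           (filterlim_scal (K := C_AbsRing) (V := C_NormedModule) a b)).
Qed.

Lemma lim_C_neq_0 {T : Type} {F : (T -> Prop) -> Prop} {FF : Filter F}
    (f : T -> C) (a : C) :
  filterlim f F (locally a) -> a <> 0 -> F (fun s => f s <> 0).
Proof.
  intros Hf Ha.
  apply Cmod_gt_0 in Ha.
  apply (proj1 (lim_C_eps f a)) with (eps := mkposreal _ Ha) in Hf.
  revert Hf; apply filter_imp; simpl; intros s Hs E.
  rewrite E in Hs.
  replace (0 - a) with (- a) in Hs by ring.
  rewrite Cmod_opp in Hs; lra.
Qed.

Lemma lim_C_inv {T : Type} {F : (T -> Prop) -> Prop} {FF : Filter F}
    (f : T -> C) (a : C) :
  filterlim f F (locally a) -> a <> 0 ->
  filterlim (fun s => / f s) F (locally (/ a)).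
Proof.
  intros Hf Ha.
  pose proof (proj1 (Cmod_gt_0 a) Ha) as Ma.
  apply lim_C_eps; intros eps.
  assert (H1 : (0 < Cmod a / 2)%R) by lra.
  assert (H2 : (0 < eps * (Cmod a * Cmod a) / 2)%R).
  { pose proof (cond_pos eps).
    assert (0 < eps * (Cmod a * Cmod a))%R
      by (repeat apply Rmult_lt_0_compat; assumption).
    lra. }
  pose proof (proj1 (lim_C_eps f a) Hf (mkposreal _ H1)) as K1.
  pose proof (proj1 (lim_C_eps f a) Hf (mkposreal _ H2)) as K2.
  generalize (filter_and _ _ K1 K2); apply filter_imp; simpl.
  intros s [L1 L2].
  assert (M : (Cmod a / 2 < Cmod (f s))%R).
  { assert (E : a = f s + - (f s - a)) by ring.
    pose proof (Cmod_triangle (f s) (- (f s - a))) as Tr.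
    rewrite <- E, Cmod_opp in Tr; lra. }
  assert (Hs : f s <> 0) by (apply Cmod_gt_0; lra).
  replace (/ f s - / a) with (- (f s - a) / (f s * a)) by (field; tauto).
  rewrite Cmod_div, Cmod_opp, Cmod_mult by (apply Cmult_neq_0; assumption).
  apply Rlt_div_l; [apply Rmult_lt_0_compat; lra |].
  apply Rlt_le_trans with (1 := L2).
  replace (eps * (Cmod a * Cmod a) / 2)%R
    with (eps * (Cmod a / 2 * Cmod a))%R by field.
  apply Rmult_le_compat_l; [apply Rlt_le, cond_pos |].
  apply Rmult_le_compat_r; lra.
Qed.

(** * Differential calculus relative to an interval *)

Lemma is_derive_within_eps (I : R -> Prop) (f : R -> C) (t : R) (l : C) :
  I t ->
  is_derive_within I f t l <->
  forall eps : posreal, within I (locally t) (fun s =>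
    (Cmod (f s - f t - RtoC (s - t) * l) <= eps * Rabs (s - t))%R).
Proof.
  intros It.
  assert (E : forall s, minus (G := C_R_NormedModule)
      (minus (f s) (f t)) (scal (K := R_AbsRing) (V := C_R_NormedModule)
        (minus (G := R_AbelianGroup) s t) l) = f s - f t - RtoC (s - t) * l).
  { intros s. rewrite scal_R_Cmult. reflexivity. }
  split.
  - intros [_ H] eps.
    assert (L : is_filter_lim (within I (locally t)) t)
      by (intros P HP; apply filter_le_within; auto with typeclass_instances).
    generalize (H t L eps); apply filter_imp; intros s.
    rewrite Cmod_norm, <- E; exact (fun h => h).
  - intros H; split; [apply is_linear_scal_l |].
    intros x Hx.
    assert (x = t) as ->.
    { destruct (Req_dec x t) as [e | n]; [exact e | exfalso].
      assert (Hp : (0 < Rabs (x - t))%R) by (apply Rabs_pos_lt; lra).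
      pose proof (Hx (ball x (mkposreal _ Hp)) (locally_ball x _)) as B.
      apply locally_singleton in B.
      specialize (B It).
      change (Rabs (t - x) < Rabs (x - t))%R in B.
      rewrite Rabs_minus_sym in B; lra. }
    intros eps; generalize (H eps); apply filter_imp; intros s.
    rewrite Cmod_norm, <- E; exact (fun h => h).
Qed.

Lemma within_imp {T : Type} {F : (T -> Prop) -> Prop} {FF : Filter F}
    {I P Q : T -> Prop} :
  within I F P -> (forall s, I s -> P s -> Q s) -> within I F Q.
Proof.
  intros HP H; revert HP; unfold within; apply filter_imp; auto.
Qed.

(** Multiplying by the slope function [phi] instead of dividing by [s - t]
    avoids a case distinction at [s = t]; each differentiation rule then reduces
    to an algebraic identity and the rules for limits. *)
Lemma is_derive_within_slope (I : R -> Prop) (f : R -> C) (t : R) (l : C) :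
  I t ->
  is_derive_within I f t l <->
  exists phi : R -> C,
    filterlim phi (within I (locally t)) (locally l) /\
    within I (locally t) (fun s => f s = f t + RtoC (s - t) * phi s).
Proof.
  intros It; rewrite (is_derive_within_eps I f t l It).
  assert (M : forall (s : R) (z : C),
    Cmod (RtoC (s - t) * z) = (Cmod z * Rabs (s - t))%R).
  { intros s z; rewrite Cmod_mult, Cmod_R; apply Rmult_comm. }
  split.
  - intros H.
    assert (NZ : forall s, s <> t -> RtoC (s - t) <> 0).
    { intros s n e; apply RtoC_inj in e; lra. }
    exists (fun s => if Req_EM_T s t then l else (f s - f t) / RtoC (s - t)).
    split.
    + apply lim_C_eps; intros eps.
      apply (within_imp (H (pos_div_2 eps))); simpl; intros s Is Hs.
      pose proof (cond_pos eps) as P.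
      destruct (Req_EM_T s t) as [e | n].
      * replace (l - l) with (RtoC 0) by ring.
        rewrite Cmod_0; exact P.
      * apply Rle_lt_trans with (eps / 2)%R; [| lra].
        apply Rmult_le_reg_r with (Rabs (s - t)); [apply Rabs_pos_lt; lra |].
        rewrite <- M.
        replace (RtoC (s - t) * ((f s - f t) / RtoC (s - t) - l))
          with (f s - f t - RtoC (s - t) * l) by (field; auto).
        exact Hs.
    + apply filter_forall; intros s.
      destruct (Req_EM_T s t) as [e | n].
      * subst s; rewrite Rminus_diag; ring.
      * field; auto.
  - intros [phi [L E]] eps.
    pose proof (proj1 (lim_C_eps phi l) L eps) as K.
    apply (within_imp (filter_and _ _ K E)); intros s Is Hs.
    destruct Hs as [Hs1 Hs2].
    replace (f s - f t - RtoC (s - t) * l) with (RtoC (s - t) * (phi s - l))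
      by (rewrite Hs2; ring).
    rewrite M; apply Rmult_le_compat_r; [apply Rabs_pos | lra].
Qed.

Lemma is_derive_within_continuous (I : R -> Prop) (f : R -> C) (t : R) (l : C) :
  I t -> is_derive_within I f t l ->
  filterlim f (within I (locally t)) (locally (f t)).
Proof.
  intros It H; apply is_derive_within_slope in H; [| exact It].
  destruct H as [phi [L E]].
  assert (Z : filterlim (fun s : R => RtoC (s - t)) (within I (locally t))
                (locally (RtoC 0))).
  { apply lim_C_eps; intros eps.
    apply filter_le_within.
    exists eps; intros s Hs.
    replace (RtoC (s - t) - 0) with (RtoC (s - t)) by ring.
    rewrite Cmod_R; exact Hs. }
  assert (K : filterlim (fun s => f t + RtoC (s - t) * phi s)
                (within I (locally t)) (locally (f t + 0 * l))).
  { apply lim_C_plus; [apply filterlim_const |].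
    apply lim_C_mult; auto. }
  replace (f t + 0 * l) with (f t) in K by ring.
  revert K; apply filterlim_ext_loc.
  apply (within_imp E); intros s _ Hs; symmetry; exact Hs.
Qed.

Lemma is_derive_within_eq (I : R -> Prop) (f g : R -> C) (t : R) (l m : C) :
  I t -> (forall s, I s -> f s = g s) -> l = m ->
  is_derive_within I f t l -> is_derive_within I g t m.
Proof.
  intros It E <- H; apply is_derive_within_eps; [exact It |]; intros eps.
  apply (within_imp (proj1 (is_derive_within_eps I f t l It) H eps)).
  intros s Is Hs; rewrite <- !E by assumption; exact Hs.
Qed.

Lemma is_derive_within_subset (I J : R -> Prop) (f : R -> C) (t : R) (l : C) :
  J t -> (forall s, J s -> I s) ->
  is_derive_within I f t l -> is_derive_within J f t l.
Proof.
  intros Jt S H; apply is_derive_within_eps; [exact Jt |]; intros eps.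
  generalize (proj1 (is_derive_within_eps I f t l (S t Jt)) H eps).
  unfold within; apply filter_imp; auto.
Qed.

Lemma is_derive_within_const (I : R -> Prop) (c : C) (t : R) :
  I t -> is_derive_within I (fun _ => c) t 0.
Proof.
  intros It; apply is_derive_within_slope; [exact It |].
  exists (fun _ => RtoC 0); split; [apply filterlim_const |].
  apply filter_forall; intros s; ring.
Qed.

Lemma is_derive_within_RtoC (I : R -> Prop) (t : R) :
  I t -> is_derive_within I RtoC t 1.
Proof.
  intros It; apply is_derive_within_slope; [exact It |].
  exists (fun _ => RtoC 1); split; [apply filterlim_const |].
  apply filter_forall; intros s; rewrite RtoC_minus; ring.
Qed.

Lemma is_derive_within_plus (I : R -> Prop) (f g : R -> C) (t : R) (l m : C) :
  I t -> is_derive_within I f t l -> is_derive_within I g t m ->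
  is_derive_within I (fun s => f s + g s) t (l + m).
Proof.
  intros It Hf Hg.
  apply is_derive_within_slope in Hf; [| exact It].
  apply is_derive_within_slope in Hg; [| exact It].
  destruct Hf as [phi [Lf Ef]]; destruct Hg as [psi [Lg Eg]].
  apply is_derive_within_slope; [exact It |].
  exists (fun s => phi s + psi s); split.
  - apply lim_C_plus; auto.
  - apply (within_imp (filter_and _ _ Ef Eg)); intros s Is Hs.
    destruct Hs as [-> ->]; ring.
Qed.

Lemma is_derive_within_mult (I : R -> Prop) (f g : R -> C) (t : R) (l m : C) :
  I t -> is_derive_within I f t l -> is_derive_within I g t m ->
  is_derive_within I (fun s => f s * g s) t (l * g t + f t * m).
Proof.
  intros It Hf Hg.
  pose proof (is_derive_within_continuous I g t m It Hg) as Cg.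
  apply is_derive_within_slope in Hf; [| exact It].
  apply is_derive_within_slope in Hg; [| exact It].
  destruct Hf as [phi [Lf Ef]]; destruct Hg as [psi [Lg Eg]].
  apply is_derive_within_slope; [exact It |].
  exists (fun s => phi s * g s + f t * psi s); split.
  - apply lim_C_plus; apply lim_C_mult; first [assumption | apply filterlim_const].
  - apply (within_imp (filter_and _ _ Ef Eg)); intros s Is Hs.
    destruct Hs as [E1 E2].
    rewrite E1, E2; ring.
Qed.

Lemma is_derive_within_scal (I : R -> Prop) (c : C) (f : R -> C) (t : R) (l : C) :
  I t -> is_derive_within I f t l ->
  is_derive_within I (fun s => c * f s) t (c * l).
Proof.
  intros It H.
  refine (is_derive_within_eq I _ _ t _ _ It (fun s _ => eq_refl) _
            (is_derive_within_mult I _ f t 0 l It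
               (is_derive_within_const I c t It) H)).
  ring.
Qed.

Lemma is_derive_within_inv (I : R -> Prop) (f : R -> C) (t : R) (l : C) :
  I t -> f t <> 0 -> is_derive_within I f t l ->
  is_derive_within I (fun s => / f s) t (- l / (f t * f t)).
Proof.
  intros It Nz Hf.
  pose proof (is_derive_within_continuous I f t l It Hf) as Cf.
  pose proof (lim_C_neq_0 f (f t) Cf Nz) as Nf.
  apply is_derive_within_slope in Hf; [| exact It].
  destruct Hf as [phi [Lf Ef]].
  apply is_derive_within_slope; [exact It |].
  exists (fun s => -(1) * phi s * / (f s * f t)); split.
  - replace (- l / (f t * f t)) with (-(1) * l * / (f t * f t))
      by (field; exact Nz).
    apply lim_C_mult.
    + apply lim_C_mult; first [assumption | apply filterlim_const].
    + apply lim_C_inv; [|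
        apply Cmult_neq_0; exact Nz].
      apply lim_C_mult; first [assumption | apply filterlim_const].
  - apply (within_imp (filter_and _ _ Ef Nf)); intros s Is Hs.
    destruct Hs as [E N].
    assert (E' : RtoC (s - t) * phi s = f s - f t) by (rewrite E; ring).
    replace (RtoC (s - t) * (-(1) * phi s * / (f s * f t)))
      with (- (RtoC (s - t) * phi s) / (f s * f t)) by (field; tauto).
    rewrite E'; field; tauto.
Qed.

(** * The complex exponential *)

Lemma Cexp_0 : Cexp 0 = 1.
Proof.
  unfold Cexp; simpl; rewrite exp_0, cos_0, sin_0.
  unfold RtoC; f_equal; ring.
Qed.

Lemma Cexp_plus (z w : C) : Cexp (z + w) = Cexp z * Cexp w.
Proof.
  unfold Cexp; rewrite re_plus, im_plus, exp_plus, cos_plus, sin_plus.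
  unfold Cmult; simpl; f_equal; ring.
Qed.

Lemma Cexp_neq_0 (z : C) : Cexp z <> 0.
Proof.
  intros H; apply C1_nz; rewrite <- Cexp_0.
  replace (RtoC 0) with (z + - z) by ring.
  rewrite Cexp_plus, H; ring.
Qed.

Lemma is_derive_expansion_0 (f : R -> R) (l : R) :
  is_derive f 0%R l ->
  forall eps : posreal, locally (T := R_UniformSpace) 0%R (fun x =>
    (Rabs (f x - f 0 - x * l) <= eps * Rabs x)%R).
Proof.
  intros [_ H] eps.
  generalize (H 0%R (fun P HP => HP) eps); apply filter_imp; intros x.
  unfold norm, minus, plus, opp, scal; simpl; unfold abs, mult; simpl.
  change (x + - 0)%R with (x - 0)%R; rewrite Rminus_0_r; exact (fun h => h).
Qed.

Lemma Cmod_le_Rabs (x y : R) : (Cmod (x, y) <= Rabs x + Rabs y)%R.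
Proof.
  replace (x, y) with (RtoC x + Ci * RtoC y)
    by (unfold Cplus, Cmult, Ci, RtoC; simpl; f_equal; ring).
  eapply Rle_trans; [apply Cmod_triangle |].
  rewrite Cmod_mult, !Cmod_R.
  replace (Cmod Ci) with 1%R; [lra |].
  symmetry; unfold Cmod, Ci; simpl.
  replace (_ + _)%R with 1%R by ring; exact sqrt_1.
Qed.

(** With [z = x + i y], the error is a sum of products in each of which one
    factor is a first-order error of [exp x], [cos y] or [sin y], except for
    the term [x sin y], which is of second order. *)
Lemma Cexp_expansion (eps : posreal) :
  locally (T := C_UniformSpace) (RtoC 0) (fun z =>
    (Cmod (Cexp z - 1 - z) <= eps * Cmod z)%R).
Proof.
  assert (He : (0 < Rmin (eps / 6) 1)%R)
    by (apply Rmin_glb_lt; [pose proof (cond_pos eps) |]; lra).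
  set (e := Rmin (eps / 6) 1) in *.
  assert (e6 : (6 * e <= eps)%R)
    by (pose proof (Rmin_l (eps / 6) 1); unfold e; lra).
  assert (e1 : (e <= 1)%R) by apply Rmin_r.
  assert (Dexp : is_derive exp 0%R 1%R)
    by (auto_derive; [exact I | rewrite exp_0; ring]).
  assert (Dcos : is_derive cos 0%R 0%R)
    by (auto_derive; [exact I | rewrite sin_0; ring]).
  assert (Dsin : is_derive sin 0%R 1%R)
    by (auto_derive; [exact I | rewrite cos_0; ring]).
  destruct (is_derive_expansion_0 _ _ Dexp (mkposreal e He)) as [d1 K1].
  destruct (is_derive_expansion_0 _ _ Dcos (mkposreal e He)) as [d2 K2].
  destruct (is_derive_expansion_0 _ _ Dsin (mkposreal e He)) as [d3 K3].
  assert (Hd : (0 < Rmin d1 (Rmin (Rmin d2 d3) (e / 2)))%R)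
    by (repeat apply Rmin_glb_lt; try apply cond_pos; lra).
  exists (mkposreal _ Hd); intros [x y] [Bx By]; simpl in Bx, By.
  assert (Bx' : ball (M := R_UniformSpace) 0%R (e / 2) x)
    by (apply (ball_le _ _ _ (Rle_trans _ _ _ (Rmin_r _ _) (Rmin_r _ _)) _ Bx)).
  apply (ball_le _ _ d1) in Bx; [| apply Rmin_l].
  assert (By' : ball (M := R_UniformSpace) 0%R (e / 2) y)
    by (apply (ball_le _ _ _ (Rle_trans _ _ _ (Rmin_r _ _) (Rmin_r _ _)) _ By)).
  apply (ball_le _ _ (Rmin d2 d3)) in By;
    [| eapply Rle_trans; [apply Rmin_r | apply Rmin_l]].
  specialize (K1 x Bx).
  specialize (K2 y (ball_le _ _ _ (Rmin_l _ _) _ By)).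
  specialize (K3 y (ball_le _ _ _ (Rmin_r _ _) _ By)).
  change (Rabs (x - 0) < e / 2)%R in Bx'; rewrite Rminus_0_r in Bx'.
  change (Rabs (y - 0) < e / 2)%R in By'; rewrite Rminus_0_r in By'.
  simpl in K1, K2, K3; rewrite exp_0 in K1; rewrite cos_0 in K2.
  rewrite sin_0 in K3.
  pose proof (re_le_Cmod (x, y)) as Mx; simpl in Mx.
  pose proof (Rle_trans _ _ _ (Rmax_r _ _) (Rmax_Cmod (x, y))) as My.
  simpl in My.
  set (M := Cmod (x, y)) in *.
  rewrite Rmult_0_r, Rminus_0_r in K2; rewrite Rmult_1_r in K1, K3.
  assert (Ks : (Rabs (sin y) <= e)%R).
  { replace (sin y) with ((sin y - 0 - y) + y)%R by ring.
    eapply Rle_trans; [apply Rabs_triang |].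
    pose proof (Rabs_pos y); nra. }
  assert (Kx : (Rabs (1 + x) <= 2)%R).
  { eapply Rle_trans; [apply Rabs_triang |]; rewrite Rabs_R1; lra. }
  replace (Cexp (x, y) - 1 - (x, y)) with
    (((exp x - 1 - x) * cos y + (1 + x) * (cos y - 1))%R,
     ((exp x - 1 - x) * sin y + (x * sin y + (sin y - 0 - y)))%R)
    by (unfold Cexp, Cminus, RtoC, Cplus, Copp; simpl; f_equal; ring).
  eapply Rle_trans; [apply Cmod_le_Rabs |].
  pose proof (Rabs_triang ((exp x - 1 - x) * cos y) ((1 + x) * (cos y - 1))) as T1.
  pose proof (Rabs_triang ((exp x - 1 - x) * sin y)
    (x * sin y + (sin y - 0 - y))) as T2.
  pose proof (Rabs_triang (x * sin y) (sin y - 0 - y)) as T3.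
  rewrite !Rabs_mult in *.
  assert (C1 : (Rabs (cos y) <= 1)%R) by (apply Rabs_le, COS_bound).
  assert (S1 : (Rabs (sin y) <= 1)%R) by (apply Rabs_le, SIN_bound).
  pose proof (Rabs_pos x) as Px; pose proof (Rabs_pos y) as Py.
  pose proof (Rabs_pos (exp x - 1 - x)) as Pe.
  pose proof (Rabs_pos (cos y - 1)) as Pc.
  pose proof (Rabs_pos (1 + x)) as P1.
  assert (Q1 : (Rabs (exp x - 1 - x) * Rabs (cos y) <= e * M)%R) by nra.
  assert (Q2 : (Rabs (1 + x) * Rabs (cos y - 1) <= 2 * (e * M))%R) by nra.
  assert (Q3 : (Rabs (exp x - 1 - x) * Rabs (sin y) <= e * M)%R) by nra.
  assert (Q4 : (Rabs x * Rabs (sin y) <= e * M)%R) by nra.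
  assert (Q5 : (Rabs (sin y - 0 - y) <= e * M)%R) by nra.
  assert (Q6 : (6 * e * M <= eps * M)%R) by nra.
  lra.
Qed.

(** The slope function of the exponential at [0]; by the addition formula it
    governs the increments of [Cexp] at every point. *)
Lemma Cexp_slope : exists E : C -> C,
  (forall z, Cexp z = 1 + z * E z) /\
  filterlim E (locally (T := C_UniformSpace) (RtoC 0))
    (locally (T := C_UniformSpace) (RtoC 1)).
Proof.
  exists (fun z => if Ceq_dec z 0 then RtoC 1 else (Cexp z - 1) / z); split.
  - intros z; destruct (Ceq_dec z 0) as [-> | n].
    + rewrite Cexp_0; ring.
    + field; exact n.
  - apply lim_C_eps; intros eps.
    pose proof (cond_pos eps) as P.
    generalize (Cexp_expansion (pos_div_2 eps)); apply filter_imp; simpl.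
    intros z Hz; destruct (Ceq_dec z 0) as [-> | n].
    + replace (1 - 1) with (RtoC 0) by ring; rewrite Cmod_0; exact P.
    + replace ((Cexp z - 1) / z - 1) with ((Cexp z - 1 - z) / z)
        by (field; exact n).
      rewrite Cmod_div by exact n; apply Cmod_gt_0 in n.
      apply Rlt_div_l; [exact n | nra].
Qed.

Lemma lim_C_increment (I : R -> Prop) (f : R -> C) (t : R) :
  filterlim f (within I (locally t)) (locally (f t)) ->
  filterlim (fun s => f s - f t) (within I (locally t)) (locally (RtoC 0)).
Proof.
  intros H; replace (RtoC 0) with (f t + - f t) by ring.
  apply lim_C_plus; [exact H | apply filterlim_const].
Qed.

Lemma is_derive_within_Cexp (I : R -> Prop) (f : R -> C) (t : R) (l : C) :
  I t -> is_derive_within I f t l ->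
  is_derive_within I (fun s => Cexp (f s)) t (l * Cexp (f t)).
Proof.
  intros It Hf; destruct Cexp_slope as [E [EE LE]].
  pose proof (is_derive_within_continuous I f t l It Hf) as Cf.
  apply is_derive_within_slope in Hf; [| exact It].
  destruct Hf as [phi [Lf Ef]].
  apply is_derive_within_slope; [exact It |].
  exists (fun s => phi s * E (f s - f t) * Cexp (f t)); split.
  - replace (l * Cexp (f t)) with (l * 1 * Cexp (f t)) by ring.
    apply lim_C_mult; [apply lim_C_mult; [exact Lf |] | apply filterlim_const].
    exact (filterlim_comp _ _ _ _ _ _ _ _ (lim_C_increment I f t Cf) LE).
  - apply (within_imp Ef); intros s _ Hs.
    replace (f s) with (f t + (f s - f t)) at 1 by ring.
    rewrite Cexp_plus, (EE (f s - f t)).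
    replace (f s - f t) with (RtoC (s - t) * phi s) at 1 by (rewrite Hs; ring).
    ring.
Qed.

(** A merely continuous logarithm is differentiable: with
    [delta = L s - L t], the relation [f s = f t * (1 + delta * E delta)] can
    be solved for [delta], because [E delta] tends to [1]. *)
Lemma is_derive_within_log (I : R -> Prop) (f L : R -> C) (t : R) (l : C) :
  I t -> (forall s, I s -> Cexp (L s) = f s) ->
  filterlim L (within I (locally t)) (locally (L t)) ->
  is_derive_within I f t l -> is_derive_within I L t (l / f t).
Proof.
  intros It HL CL Hf; destruct Cexp_slope as [E [EE LE]].
  assert (Nz : f t <> 0) by (rewrite <- HL by exact It; apply Cexp_neq_0).
  assert (K : filterlim (fun s => E (L s - L t)) (within I (locally t))
                (locally (RtoC 1)))
    by exact (filterlim_comp _ _ _ _ _ _ _ _ (lim_C_increment I L t CL) LE).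
  pose proof (lim_C_neq_0 _ _ K C1_nz) as NE.
  apply is_derive_within_slope in Hf; [| exact It].
  destruct Hf as [phi [Lf Ef]].
  apply is_derive_within_slope; [exact It |].
  exists (fun s => phi s * / (f t * E (L s - L t))); split.
  - replace (l / f t) with (l * / (f t * 1)) by (field; exact Nz).
    apply lim_C_mult; [exact Lf |].
    apply lim_C_inv; [| apply Cmult_neq_0; [exact Nz | exact C1_nz]].
    apply lim_C_mult; [apply filterlim_const | exact K].
  - apply (within_imp (filter_and _ _ Ef NE)); intros s Is [Hs Ns].
    assert (D : RtoC (s - t) * phi s = f t * ((L s - L t) * E (L s - L t))).
    { replace (RtoC (s - t) * phi s) with (f s - f t) by (rewrite Hs; ring).
      rewrite <- (HL s Is), <- (HL t It).
      replace (L s) with (L t + (L s - L t)) at 1 by ring.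
      rewrite Cexp_plus, (EE (L s - L t)); ring. }
    rewrite Cmult_assoc, D; field; tauto.
Qed.

(** * Primitives and uniqueness for linear equations *)

(** Composition with the projection onto the segment from [a] to [b] extends a
    function on that segment to the whole line and turns continuity relative to
    the segment into plain continuity, so that the mean value theorem and the
    Riemann integral become available. *)
Definition clamp (a b s : R) : R := Rmax a (Rmin s b).

Lemma clamp_bounds (a b s : R) : (a <= b)%R -> (a <= clamp a b s <= b)%R.
Proof.
  unfold clamp, Rmax, Rmin; repeat destruct Rle_dec; lra.
Qed.

Lemma clamp_id (a b s : R) : (a <= s <= b)%R -> clamp a b s = s.
Proof.
  unfold clamp, Rmax, Rmin; repeat destruct Rle_dec; lra.
Qed.

Lemma clamp_lim (I : R -> Prop) (a b s : R) :
  (a <= b)%R -> (forall r, (a <= r <= b)%R -> I r) ->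
  filterlim (clamp a b) (locally s) (within I (locally (clamp a b s))).
Proof.
  intros Hab S P [d Hd]; exists d; intros r Hr.
  apply Hd; [| apply S, clamp_bounds, Hab].
  apply Rle_lt_trans with (2 := Hr).
  change (Rabs (clamp a b r - clamp a b s) <= Rabs (r - s))%R.
  unfold clamp, Rmax, Rmin; repeat destruct Rle_dec; split_Rabs; lra.
Qed.

Lemma is_interval_Rmin_Rmax (I : R -> Prop) (a b : R) :
  is_interval I -> I a -> I b ->
  forall r, (Rmin a b <= r <= Rmax a b)%R -> I r.
Proof.
  intros HI Ia Ib r Hr.
  apply (HI (Rmin a b) (Rmax a b)); [| | exact Hr].
  - apply Rmin_case; assumption.
  - apply Rmax_case; assumption.
Qed.

(** The mean value theorem holds for real-valued functions only, hence the real
    part; multiplication by [Ci] then gives the imaginary part. *)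
Lemma is_derive_within_0_Re (I : R -> Prop) (f : R -> C) (a b : R) :
  is_interval I -> I a -> I b ->
  (forall s, I s -> is_derive_within I f s 0) -> Re (f a) = Re (f b).
Proof.
  intros HI Ia Ib Hf.
  pose proof (is_interval_Rmin_Rmax I a b HI Ia Ib) as S.
  set (m := Rmin a b) in *; set (M := Rmax a b) in *.
  assert (HmM : (m <= M)%R) by apply Rminmax.
  destruct (MVT_gen (fun s => Re (f (clamp m M s))) a b (fun _ => 0%R))
    as [c [_ Hc]].
  - fold m M; intros s Hs; split; [apply is_linear_scal_l |].
    intros y Hy; rewrite <- (is_filter_lim_locally_unique s y Hy); intros eps.
    assert (Is : I s) by (apply S; lra).
    pose proof (proj1 (is_derive_within_eps I f s 0 Is) (Hf s Is) eps) as K.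
    generalize (filter_and (F := locally s) _ _ K (filter_and _ _
      (open_gt m s (proj1 Hs)) (open_lt M s (proj2 Hs)))).
    apply filter_imp; intros r [Kr Br].
    specialize (Kr (S r ltac:(lra))).
    rewrite !clamp_id by lra.
    eapply Rle_trans; [| exact Kr].
    eapply Rle_trans; [| apply re_le_Cmod].
    apply Req_le.
    change (Rabs ((Re (f r) - Re (f s)) - (r - s) * 0)
            = Rabs (Re (f r - f s - RtoC (r - s) * 0)))%R.
    f_equal; unfold Re, Cminus, Cplus, Cmult, Copp, RtoC; simpl; ring.
  - fold m M; intros s _; apply continuity_pt_filterlim.
    pose proof (clamp_lim I m M s HmM S) as L.
    assert (Ic : I (clamp m M s)) by (apply S, clamp_bounds, HmM).
    pose proof (is_derive_within_continuous I f _ 0 Ic (Hf _ Ic)) as Cf.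
    pose proof (filterlim_comp _ _ _ _ _ _ _ _ L Cf) as K.
    intros P [d Hd]; apply (K (fun z => P (Re z))).
    exists d; intros z [Hz _]; apply Hd, Hz.
  - rewrite !clamp_id in Hc;
      [lra | split; [apply Rmin_l | apply Rmax_l]
           | split; [apply Rmin_r | apply Rmax_r]].
Qed.

Lemma is_derive_within_0_eq (I : R -> Prop) (f : R -> C) (a b : R) :
  is_interval I -> I a -> I b ->
  (forall s, I s -> is_derive_within I f s 0) -> f a = f b.
Proof.
  intros HI Ia Ib Hf.
  assert (E1 : Re (f a) = Re (f b))
    by (apply (is_derive_within_0_Re I f); assumption).
  assert (E2 : Re (Ci * f a) = Re (Ci * f b)).
  { apply (is_derive_within_0_Re I (fun s => Ci * f s)); try assumption.
    intros s Is; replace (RtoC 0) with (Ci * 0) by ring.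
    apply is_derive_within_scal; auto. }
  rewrite !(Cmult_comm Ci), !re_mult_Ci in E2.
  destruct (f a) as [x y]; destruct (f b) as [x' y']; simpl in E1, E2.
  f_equal; lra.
Qed.

Lemma is_derive_within_of_is_derive (I : R -> Prop) (f : R -> C) (t : R) (l : C) :
  I t -> is_derive (K := R_AbsRing) (V := C_R_NormedModule) f t l ->
  is_derive_within I f t l.
Proof.
  intros It [_ H]; apply is_derive_within_eps; [exact It |]; intros eps.
  apply filter_le_within.
  generalize (H t (fun P HP => HP) eps); apply filter_imp; intros s.
  rewrite Cmod_norm, <- scal_R_Cmult; exact (fun h => h).
Qed.

(** Uniqueness by an integrating factor: [w exp (- int g)] has derivative
    zero. *)
Lemma linear_ode_zero (I : R -> Prop) (g w : R -> C) (a : R) :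
  is_interval I -> I a -> continuous_on I g ->
  (forall s, I s -> is_derive_within I w s (g s * w s)) ->
  w a = 0 -> forall t, I t -> w t = 0.
Proof.
  intros HI Ia Cg Hw wa b Ib.
  pose proof (is_interval_Rmin_Rmax I a b HI Ia Ib) as S.
  set (m := Rmin a b) in *; set (M := Rmax a b) in *.
  assert (HmM : (m <= M)%R) by apply Rminmax.
  set (J := fun r => (m <= r <= M)%R).
  assert (JI : is_interval J) by (unfold is_interval, J; intros; lra).
  assert (Ja : J a) by (split; [apply Rmin_l | apply Rmax_l]).
  assert (Jb : J b) by (split; [apply Rmin_r | apply Rmax_r]).
  set (h := fun s => g (clamp m M s)).
  assert (Ch : forall s, continuous (U := C_R_CompleteNormedModule) h s).
  { intros s; exact (filterlim_comp _ _ _ _ _ _ _ _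
      (clamp_lim I m M s HmM S) (Cg _ (S _ (clamp_bounds m M s HmM)))). }
  set (G := fun s => RInt (V := C_R_CompleteNormedModule) h a s).
  assert (DG : forall s, J s -> is_derive_within J G s (g s)).
  { intros s Js.
    assert (D : is_derive (K := R_AbsRing) (V := C_R_NormedModule) G s (h s)).
    { apply (is_derive_RInt (V := C_R_CompleteNormedModule) h G a s); [| apply Ch].
      apply filter_forall; intros r.
      apply (RInt_correct (V := C_R_CompleteNormedModule) h).
      apply (ex_RInt_continuous (V := C_R_CompleteNormedModule)).
      intros; apply Ch. }
    unfold h in D; rewrite (clamp_id m M s Js) in D.
    exact (is_derive_within_of_is_derive J G s _ Js D). }
  set (F := fun s => w s * Cexp (-(1) * G s)).
  assert (E : F a = F b).
  { apply (is_derive_within_0_eq J); try assumption; intros s Js.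
    refine (is_derive_within_eq J F F s _ 0 Js (fun _ _ => eq_refl) _
      (is_derive_within_mult J w (fun s => Cexp (-(1) * G s)) s (g s * w s) _ Js
        (is_derive_within_subset I J w s _ Js S (Hw s (S s Js)))
        (is_derive_within_Cexp J _ s _ Js
          (is_derive_within_scal J (-(1)) G s _ Js (DG s Js))))).
    ring. }
  unfold F in E; rewrite wa, Cmult_0_l in E.
  destruct (Ceq_dec (w b) 0) as [e | n]; [exact e | exfalso].
  symmetry in E; revert E; apply Cmult_neq_0; [exact n | apply Cexp_neq_0].
Qed.

(** * Branches of powers *)

(** The logarithm is the primitive [L] of [f' / f], since [f exp (- L)] then
    has derivative zero.  Openness of [D] makes the Riemann integral
    differentiable at every point of [D]. *)
Lemma continuous_log_exists (D : R -> Prop) (f f' : R -> C) (a : R) :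
  is_interval D -> (forall s, D s -> locally s D) -> D a ->
  (forall s, D s -> is_derive_within D f s (f' s)) -> continuous_on D f' ->
  (forall s, D s -> f s <> 0) -> f a = 1 ->
  exists L : R -> C,
    L a = 0 /\ continuous_on D L /\ forall s, D s -> Cexp (L s) = f s.
Proof.
  intros HI OD Da Df Cf' Nz fa.
  set (h := fun s => f' s * / f s).
  assert (Ch : forall s, D s -> continuous (U := C_R_CompleteNormedModule) h s).
  { intros s Ds.
    assert (K : filterlim h (within D (locally s)) (locally (h s))).
    { apply lim_C_mult; [exact (Cf' s Ds) |].
      apply lim_C_inv; [| exact (Nz s Ds)].
      exact (is_derive_within_continuous D f s _ Ds (Df s Ds)). }
    intros P HP; change (locally s (fun r => P (h r))).
    generalize (filter_and (F := locally s) _ _ (K P HP) (OD s Ds)).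
    apply filter_imp; intros r [H1 H2]; exact (H1 H2). }
  set (L := fun s => RInt (V := C_R_CompleteNormedModule) h a s).
  assert (DL : forall s, D s -> is_derive_within D L s (h s)).
  { intros s Ds; apply is_derive_within_of_is_derive; [exact Ds |].
    apply (is_derive_RInt (V := C_R_CompleteNormedModule) h L a s);
      [| exact (Ch s Ds)].
    generalize (OD s Ds); apply filter_imp; intros r Dr.
    apply (RInt_correct (V := C_R_CompleteNormedModule) h).
    apply (ex_RInt_continuous (V := C_R_CompleteNormedModule)).
    intros z Hz; apply Ch, (is_interval_Rmin_Rmax D a r); assumption. }
  assert (La : L a = RtoC 0) by apply (RInt_point (V := C_R_CompleteNormedModule)).
  exists L; split; [exact La | split].
  - intros s Ds; exact (is_derive_within_continuous D L s _ Ds (DL s Ds)).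
  - intros s Ds.
    set (F := fun s => f s * Cexp (-(1) * L s)).
    assert (E : F a = F s).
    { apply (is_derive_within_0_eq D); try assumption; intros r Dr.
      refine (is_derive_within_eq D F F r _ 0 Dr (fun _ _ => eq_refl) _
        (is_derive_within_mult D f (fun s => Cexp (-(1) * L s)) r _ _ Dr
          (Df r Dr) (is_derive_within_Cexp D _ r _ Dr
            (is_derive_within_scal D (-(1)) L r _ Dr (DL r Dr))))).
      unfold h; field; exact (Nz r Dr). }
    unfold F in E; rewrite fa, La in E.
    replace (-(1) * 0) with (RtoC 0) in E by ring.
    rewrite Cexp_0 in E.
    replace (Cexp (L s)) with (1 * 1 * Cexp (L s)) by ring.
    rewrite E, <- Cmult_assoc, <- Cexp_plus.
    replace (-(1) * L s + L s) with (RtoC 0) by ring.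
    rewrite Cexp_0; ring.
Qed.

Lemma is_power_branch_subset (I J : R -> Prop) (f : R -> C) (alpha : C)
    (p : R -> C) :
  (forall t, J t -> I t) -> is_power_branch I f alpha p ->
  is_power_branch J f alpha p.
Proof.
  intros S [p0 [L [CL HL]]]; split; [exact p0 |].
  exists L; split; [| auto].
  intros t Jt P HP; generalize (CL t (S t Jt) P HP).
  unfold filtermap, within; apply filter_imp; auto.
Qed.

Lemma is_derive_within_power_branch (I : R -> Prop) (f : R -> C) (alpha : C)
    (p : R -> C) (t : R) (l : C) :
  I t -> is_power_branch I f alpha p -> is_derive_within I f t l ->
  is_derive_within I p t (alpha * (l / f t) * p t).
Proof.
  intros It [_ [L [CL HL]]] Hf.
  assert (DL : is_derive_within I L t (l / f t)).
  { apply is_derive_within_log; try assumption.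
    - intros s Is; apply HL, Is.
    - exact (CL t It). }
  refine (is_derive_within_eq I _ p t _ _ It _ _
    (is_derive_within_Cexp I _ t _ It
      (is_derive_within_scal I alpha L t _ It DL))).
  - intros s Is; symmetry; apply HL, Is.
  - rewrite (proj2 (HL t It)); reflexivity.
Qed.

Lemma is_derive_within_line (I : R -> Prop) (c : C) (t : R) :
  I t -> is_derive_within I (fun s => 1 - c * RtoC s) t (- c).
Proof.
  intros It.
  refine (is_derive_within_eq I (fun s => 1 + - c * RtoC s) _ t _ _ It _ _
    (is_derive_within_plus I _ _ t _ _ It (is_derive_within_const I 1 t It)
      (is_derive_within_scal I (- c) _ t _ It (is_derive_within_RtoC I t It)))).
  - intros s _; ring.
  - ring.
Qed.

(** If [c] is not real, then [1 - c t] has no real zero.  If [c] is real, an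
    interval containing [0] on which [1 - c t] does not vanish lies in the set
    where [c t < 1].  In both cases it lies in an open interval on which
    [1 - c t] does not vanish, as [continuous_log_exists] requires. *)
Lemma power_branch_line_exists (I : R -> Prop) (c alpha : C) :
  is_interval I -> I 0%R -> (forall t : R, I t -> 1 - c * RtoC t <> 0) ->
  exists p : R -> C, is_power_branch I (fun t => 1 - c * RtoC t) alpha p.
Proof.
  intros HI I0 Nz.
  set (D := fun t : R => Im c <> 0%R \/ (Re c * t < 1)%R).
  assert (E : forall t : R, 1 - c * RtoC t = (1 - Re c * t, - Im c * t)%R).
  { intros t; destruct c as [x y].
    unfold Cminus, Cplus, Cmult, Copp, RtoC; simpl; f_equal; ring. }
  assert (ID : forall t, I t -> D t).
  { intros t It; unfold D.
    destruct (Req_dec (Im c) 0) as [H0 | H0]; [right | left; exact H0].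
    apply Rnot_le_lt; intros Hle.
    assert (Hc : Re c <> 0%R) by (intros e; rewrite e in Hle; lra).
    (* Otherwise the zero 1 / c of the line lies between 0 and t. *)
    apply (Nz (/ Re c)%R).
    - assert (Hr : (Re c * / Re c = 1)%R) by (field; exact Hc).
      destruct (Rlt_le_dec 0 (Re c)) as [Hp | Hn].
      + pose proof (Rinv_0_lt_compat _ Hp).
        apply (HI 0%R t); [exact I0 | exact It | nra].
      + assert (Hn' : (Re c < 0)%R) by lra.
        pose proof (Rinv_lt_0_compat _ Hn').
        apply (HI t 0%R); [exact It | exact I0 | nra].
    - rewrite E, H0; unfold RtoC; f_equal; [field; exact Hc | ring]. }
  destruct (continuous_log_exists D (fun t => 1 - c * RtoC t) (fun _ => - c) 0)
    as [L [L0 [CL HL]]].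
  - intros s r t Ds Dr [H1 H2]; unfold D in *.
    destruct Ds as [Ds | Ds]; [tauto |]; destruct Dr as [Dr | Dr]; [tauto |].
    right; destruct (Rle_dec 0 (Re c)); nra.
  - intros s [Ds | Ds].
    + apply filter_forall; intros r; left; exact Ds.
    + assert (O : open (fun r => (Re c * r < 1)%R)).
      { apply (open_comp (fun r => (Re c * r)%R) (fun v => (v < 1)%R)).
        - intros r _; apply (continuous_mult (fun _ : R => Re c) (fun v : R => v));
            [apply continuous_const | apply continuous_id].
        - apply open_lt. }
      generalize (O s Ds); apply filter_imp; intros r Hr; right; exact Hr.
  - right; lra.
  - intros s Ds; apply is_derive_within_line; exact Ds.
  - intros s _; apply filterlim_const.
  - intros s Ds e; rewrite E in e.
    injection e as e1 e2.
    assert (Hp : (Im c * s = 0)%R) by lra.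
    apply Rmult_integral in Hp; destruct Ds as [Ds | Ds]; [| lra].
    destruct Hp as [Hp | Hp]; [tauto |].
    rewrite Hp in e1; lra.
  - ring.
  - exists (fun t => Cexp (alpha * L t)).
    apply (is_power_branch_subset D I); [exact ID | split].
    + rewrite L0; replace (alpha * 0) with (RtoC 0) by ring; apply Cexp_0.
    + exists L; split; [exact CL | auto].
Qed.

(** * The two quadratic systems *)

Lemma solves_ivp_ext (I : R -> Prop) (F1 F2 : C -> C -> C) (z10 z20 : C)
    (z1 z2 w1 w2 : R -> C) :
  I 0%R -> (forall t, I t -> w1 t = z1 t /\ w2 t = z2 t) ->
  solves_ivp I F1 F2 z10 z20 z1 z2 -> solves_ivp I F1 F2 z10 z20 w1 w2.
Proof.
  intros I0 E [H1 [H2 H]].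
  destruct (E _ I0) as [E1 E2].
  split; [congruence | split; [congruence |]].
  intros t It; destruct (E t It) as [-> ->]; destruct (H t It) as [D1 D2]; split.
  - refine (is_derive_within_eq I z1 w1 t _ _ It _ eq_refl D1).
    intros s Is; symmetry; apply E, Is.
  - refine (is_derive_within_eq I z2 w2 t _ _ It _ eq_refl D2).
    intros s Is; symmetry; apply E, Is.
Qed.

Lemma is_derive_within_linear2 (I : R -> Prop) (p q : C) (f g : R -> C) (t : R)
    (l m : C) :
  I t -> is_derive_within I f t l -> is_derive_within I g t m ->
  is_derive_within I (fun s => p * f s + q * g s) t (p * l + q * m).
Proof.
  intros It Hf Hg; apply (is_derive_within_plus I (fun s => p * f s)
    (fun s => q * g s) t); [exact It | |]; apply is_derive_within_scal; assumption.
Qed.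

Lemma solves_ivp_linear (I : R -> Prop) (F1 F2 G1 G2 : C -> C -> C)
    (p11 p12 p21 p22 z10 z20 : C) (z1 z2 w1 w2 : R -> C) :
  I 0%R ->
  (forall u v, G1 (p11 * u + p12 * v) (p21 * u + p22 * v)
               = p11 * F1 u v + p12 * F2 u v) ->
  (forall u v, G2 (p11 * u + p12 * v) (p21 * u + p22 * v)
               = p21 * F1 u v + p22 * F2 u v) ->
  (forall t, I t -> w1 t = p11 * z1 t + p12 * z2 t /\
                    w2 t = p21 * z1 t + p22 * z2 t) ->
  solves_ivp I F1 F2 z10 z20 z1 z2 ->
  solves_ivp I G1 G2 (p11 * z10 + p12 * z20) (p21 * z10 + p22 * z20) w1 w2.
Proof.
  intros I0 HG1 HG2 E [H1 [H2 H]].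
  apply (solves_ivp_ext I G1 G2 _ _ (fun t => p11 * z1 t + p12 * z2 t)
           (fun t => p21 * z1 t + p22 * z2 t)); [exact I0 | exact E |].
  split; [rewrite H1, H2; reflexivity |].
  split; [rewrite H1, H2; reflexivity |].
  intros t It; rewrite HG1, HG2; destruct (H t It) as [D1 D2].
  split; apply is_derive_within_linear2; assumption.
Qed.

(** The difference of two solutions of the triangular system solves, first in
    [y1] and then in [y2], a homogeneous linear equation whose coefficient is
    continuous because it is built from the two solutions. *)
Lemma riccati_system_unique (I : R -> Prop) (rho1 rho2 y10 y20 : C)
    (y1 y2 z1 z2 : R -> C) :
  is_interval I -> I 0%R ->
  let F1 := fun y1 y2 : C => y1 ^ 2 in
  let F2 := fun y1 y2 : C => rho1 * y1 ^ 2 + rho2 * y1 * y2 + y2 ^ 2 in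
  solves_ivp I F1 F2 y10 y20 y1 y2 -> solves_ivp I F1 F2 y10 y20 z1 z2 ->
  forall t, I t -> y1 t = z1 t /\ y2 t = z2 t.
Proof.
  intros HI I0 F1 F2 [Y1 [Y2 HY]] [Z1 [Z2 HZ]].
  assert (Cont : forall (f : R -> C) (G : R -> C),
    (forall t, I t -> is_derive_within I f t (G t)) -> continuous_on I f).
  { intros f G Hf t It; exact (is_derive_within_continuous I f t _ It (Hf t It)). }
  assert (CY1 := Cont y1 _ (fun t It => proj1 (HY t It))).
  assert (CY2 := Cont y2 _ (fun t It => proj2 (HY t It))).
  assert (CZ1 := Cont z1 _ (fun t It => proj1 (HZ t It))).
  assert (CZ2 := Cont z2 _ (fun t It => proj2 (HZ t It))).
  assert (E1 : forall t, I t -> y1 t = z1 t).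
  { intros t It; apply Ceq_minus.
    transitivity (1 * y1 t + -(1) * z1 t); [ring |].
    apply (linear_ode_zero I (fun s => y1 s + z1 s)
             (fun s => 1 * y1 s + -(1) * z1 s) 0%R); try assumption.
    - intros s Is; apply lim_C_plus; [apply CY1 | apply CZ1]; exact Is.
    - intros s Is.
      refine (is_derive_within_eq I _ _ s _ _ Is (fun _ _ => eq_refl) _
        (is_derive_within_linear2 I 1 (-(1)) y1 z1 s _ _ Is
          (proj1 (HY s Is)) (proj1 (HZ s Is)))).
      unfold F1; ring.
    - rewrite Y1, Z1; ring. }
  intros t It; split; [exact (E1 t It) |].
  apply Ceq_minus.
  transitivity (1 * y2 t + -(1) * z2 t); [ring |].
  apply (linear_ode_zero I (fun s => rho2 * y1 s + (y2 s + z2 s))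
           (fun s => 1 * y2 s + -(1) * z2 s) 0%R); try assumption.
  - intros s Is; apply lim_C_plus.
    + apply lim_C_mult; [apply filterlim_const | apply CY1; exact Is].
    + apply lim_C_plus; [apply CY2 | apply CZ2]; exact Is.
  - intros s Is.
    refine (is_derive_within_eq I _ _ s _ _ Is (fun _ _ => eq_refl) _
      (is_derive_within_linear2 I 1 (-(1)) y2 z2 s _ _ Is
        (proj2 (HY s Is)) (proj2 (HZ s Is)))).
    unfold F2; rewrite (E1 s Is); ring.
  - rewrite Y2, Z2; ring.
Qed.

(** Once [Delta], [rho1] and [rho2] are expressed by the roots, as [up - um],
    [up um] and [1 - (up + um)], the equations become rational identities in
    [up], [um], [u0], [p t] and [y10], since [p' = Delta y1 p]. *)
Lemma riccati_system_formula (I : R -> Prop) (rho1 rho2 y10 y20 Delta : C)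
    (p : R -> C) :
  Delta ^ 2 = (1 - rho2) ^ 2 - 4 * rho1 -> Delta <> 0 -> y10 <> 0 -> I 0%R ->
  let up := (1 - rho2 + Delta) / 2 in
  let um := (1 - rho2 - Delta) / 2 in
  let u0 := y20 / y10 in
  let d := fun t : R => 1 - y10 * t in
  let den := fun t : R => u0 - um - (u0 - up) * p t in
  let u := fun t : R => (up * (u0 - um) - um * (u0 - up) * p t) / den t in
  is_power_branch I d (- Delta) p ->
  (forall t : R, I t -> d t <> 0 /\ den t <> 0) ->
  u 0%R = u0 /\
  solves_ivp I (fun y1 y2 : C => y1 ^ 2)
    (fun y1 y2 : C => rho1 * y1 ^ 2 + rho2 * y1 * y2 + y2 ^ 2) y10 y20
    (fun t => y10 / d t) (fun t => y10 / d t * u t).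
Proof.
  intros HD ND Ny I0 up um u0 d den u Hp Nz.
  assert (N2 : RtoC 2 <> 0) by (intros e; apply RtoC_inj in e; lra).
  assert (N4 : RtoC 4 <> 0) by (intros e; apply RtoC_inj in e; lra).
  assert (Hsum : 1 - rho2 = up + um) by (unfold up, um; field; exact N2).
  assert (Hdif : Delta = up - um) by (unfold up, um; field; exact N2).
  assert (Hrho : rho1 = up * um).
  { transitivity (((1 - rho2) ^ 2 - Delta ^ 2) / 4).
    - rewrite HD; field; exact N4.
    - unfold up, um; field; tauto. }
  assert (Hrho2 : rho2 = 1 - (up + um)) by (rewrite <- Hsum; ring).
  clearbody up um; subst Delta.
  assert (Eu : u 0%R = u0).
  { unfold u, den; rewrite (proj1 Hp); field.
    replace (u0 - um - (u0 - up)) with (up - um) by ring; exact ND. }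
  split; [exact Eu |].
  assert (Ed : d 0%R = 1) by (unfold d; ring).
  split; [rewrite Ed; field |].
  split; [rewrite Eu, Ed; unfold u0; field; exact Ny |].
  intros t It; destruct (Nz t It) as [Nd Nden].
  assert (Dd : is_derive_within I d t (- y10))
    by (apply is_derive_within_line; exact It).
  assert (Dp := is_derive_within_power_branch I d _ p t _ It Hp Dd).
  assert (D1 := is_derive_within_scal I y10 _ t _ It
    (is_derive_within_inv I d t _ It Nd Dd)).
  split.
  - refine (is_derive_within_eq I _ _ t _ _ It (fun _ _ => eq_refl) _ D1).
    field; exact Nd.
  - assert (Dden : is_derive_within I den t
      ((up - u0) * (- (up - um) * (- y10 / d t) * p t))).
    { refine (is_derive_within_eq I (fun s => (u0 - um) + (up - u0) * p s)
        den t _ _ It _ _ (is_derive_within_plus I _ _ t _ _ It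
          (is_derive_within_const I (u0 - um) t It)
          (is_derive_within_scal I (up - u0) p t _ It Dp))).
      - intros s _; unfold den; ring.
      - ring. }
    assert (Dnum := is_derive_within_plus I _ _ t _ _ It
      (is_derive_within_const I (up * (u0 - um)) t It)
      (is_derive_within_scal I (- (um * (u0 - up))) p t _ It Dp)).
    refine (is_derive_within_eq I _ (fun s => y10 / d s * u s) t _ _ It _ _
      (is_derive_within_mult I _ _ t _ _ It D1
        (is_derive_within_mult I _ _ t _ _ It Dnum
          (is_derive_within_inv I den t _ It Nden Dden)))).
    + intros s Is; unfold u; destruct (Nz s Is); field; tauto.
    + rewrite Hrho, Hrho2; unfold u, den.
      unfold den in Nden; clearbody u0; field; tauto.
Qed.

Theorem mainTheorem2 (rho1 rho2 a11 a12 a21 a22 b11 b12 b21 b22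
    c11 c12 c13 c21 c22 c23 : C) :
  (inverse_entries a11 a12 a21 a22 b11 b12 b21 b22 <->
   inverse_entries b11 b12 b21 b22 a11 a12 a21 a22) /\
  (inverse_entries a11 a12 a21 a22 b11 b12 b21 b22 ->
   c11 = b11 * a11 ^ 2
         + b12 * (rho1 * a11 ^ 2 + (rho2 * a11 + a21) * a21) ->
   c12 = 2 * b11 * a11 * a12
         + b12 * (2 * rho1 * a11 * a12 + rho2 * (a11 * a22 + a12 * a21)
                  + 2 * a21 * a22) ->
   c13 = b11 * a12 ^ 2
         + b12 * (rho1 * a12 ^ 2 + (rho2 * a12 + a22) * a22) ->
   c21 = b21 * a11 ^ 2
         + b22 * (rho1 * a11 ^ 2 + (rho2 * a11 + a21) * a21) ->
   c22 = 2 * b21 * a11 * a12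
         + b22 * (2 * rho1 * a11 * a12 + rho2 * (a11 * a22 + a12 * a21)
                  + 2 * a21 * a22) ->
   c23 = b21 * a12 ^ 2
         + b22 * (rho1 * a12 ^ 2 + (rho2 * a12 + a22) * a22) ->
   let Fx1 := fun x1 x2 : C => c11 * x1 ^ 2 + c12 * x1 * x2 + c13 * x2 ^ 2 in
   let Fx2 := fun x1 x2 : C => c21 * x1 ^ 2 + c22 * x1 * x2 + c23 * x2 ^ 2 in
   let Fy1 := fun y1 y2 : C => y1 ^ 2 in
   let Fy2 := fun y1 y2 : C => rho1 * y1 ^ 2 + rho2 * y1 * y2 + y2 ^ 2 in
   b11 * b22 - b12 * b21 = / (a11 * a22 - a12 * a21) /\
   (forall x1 x2 y1 y2 : C,
      (x1 = b11 * y1 + b12 * y2 /\ x2 = b21 * y1 + b22 * y2) <->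
      (y1 = a11 * x1 + a12 * x2 /\ y2 = a21 * x1 + a22 * x2)) /\
   forall x10 x20 : C,
   let y10 := a11 * x10 + a12 * x20 in
   let y20 := a21 * x10 + a22 * x20 in
   (* x solves its initial-value problem iff x = b y with y solving its own *)
   (forall (I : R -> Prop) (x1 x2 y1 y2 : R -> C),
      is_interval I -> I 0%R ->
      (forall t : R, I t -> x1 t = b11 * y1 t + b12 * y2 t /\
                            x2 t = b21 * y1 t + b22 * y2 t) ->
      (solves_ivp I Fx1 Fx2 x10 x20 x1 x2 <->
       solves_ivp I Fy1 Fy2 y10 y20 y1 y2)) /\
   (* explicit solution; Delta is either of the two square roots *)
   (forall Delta : C,
      Delta ^ 2 = (1 - rho2) ^ 2 - 4 * rho1 ->
      Delta <> 0 -> y10 <> 0 ->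
      let up := (1 - rho2 + Delta) / 2 in
      let um := (1 - rho2 - Delta) / 2 in
      let u0 := y20 / y10 in
      let d := fun t : R => 1 - y10 * t in
      let den := fun (p : R -> C) (t : R) =>
        u0 - um - (u0 - up) * p t in
      let u := fun (p : R -> C) (t : R) =>
        (up * (u0 - um) - um * (u0 - up) * p t) / den p t in
      let Y1 := fun t : R => y10 / d t in
      let Y2 := fun (p : R -> C) (t : R) => y10 / d t * u p t in
      (* the power is defined wherever 1 - y1(0) t does not vanish *)
      (forall I : R -> Prop, is_interval I -> I 0%R ->
         (forall t : R, I t -> d t <> 0) ->
         exists p : R -> C, is_power_branch I d (- Delta) p) /\
      (* the denominators do not vanish near 0 *)
      (exists eps : R, (0 < eps)%R /\
         exists p : R -> C,
           is_power_branch (fun t : R => (Rabs t < eps)%R) d (- Delta) p /\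
           forall t : R, (Rabs t < eps)%R -> d t <> 0 /\ den p t <> 0) /\
      (* the formulas give the unique solution on every admissible interval *)
      (forall (I : R -> Prop) (p : R -> C),
         is_interval I -> I 0%R ->
         is_power_branch I d (- Delta) p ->
         (forall t : R, I t -> d t <> 0 /\ den p t <> 0) ->
         u p 0%R = u0 /\
         (forall y1 y2 : R -> C,
            solves_ivp I Fy1 Fy2 y10 y20 y1 y2 <->
            (forall t : R, I t -> y1 t = Y1 t /\ y2 t = Y2 p t)) /\
         (forall x1 x2 : R -> C,
            solves_ivp I Fx1 Fx2 x10 x20 x1 x2 <->
            (forall t : R, I t -> x1 t = b11 * Y1 t + b12 * Y2 p t /\
                                  x2 t = b21 * Y1 t + b22 * Y2 p t))))).
Proof.
  assert (Sym : forall p11 p12 p21 p22 q11 q12 q21 q22 : C,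
    inverse_entries p11 p12 p21 p22 q11 q12 q21 q22 ->
    inverse_entries q11 q12 q21 q22 p11 p12 p21 p22).
  { intros p11 p12 p21 p22 q11 q12 q21 q22 [NP [-> [-> [-> ->]]]].
    set (P := p11 * p22 - p12 * p21) in *.
    assert (E : p22 / P * (p11 / P) - - (p12 / P) * - (p21 / P) = / P).
    { transitivity ((p11 * p22 - p12 * p21) / (P * P)); [field; exact NP |].
      fold P; field; exact NP. }
    unfold inverse_entries; rewrite E.
    assert (NQ : / P <> 0).
    { intros e; apply C1_nz; rewrite <- (Cinv_r P NP), e; ring. }
    clearbody P; repeat split; [exact NQ | | | |]; field; exact NP. }
  split; [split; apply Sym |].
  intros [NA [Hb11 [Hb12 [Hb21 Hb22]]]] Hc11 Hc12 Hc13 Hc21 Hc22 Hc23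
    Fx1 Fx2 Fy1 Fy2.
  assert (HB : b11 * b22 - b12 * b21 = / (a11 * a22 - a12 * a21))
    by (subst b11 b12 b21 b22; field; exact NA).
  assert (Hyx : forall x1 x2,
    b11 * (a11 * x1 + a12 * x2) + b12 * (a21 * x1 + a22 * x2) = x1 /\
    b21 * (a11 * x1 + a12 * x2) + b22 * (a21 * x1 + a22 * x2) = x2)
    by (intros; subst b11 b12 b21 b22; split; field; exact NA).
  assert (Hxy : forall y1 y2,
    a11 * (b11 * y1 + b12 * y2) + a12 * (b21 * y1 + b22 * y2) = y1 /\
    a21 * (b11 * y1 + b12 * y2) + a22 * (b21 * y1 + b22 * y2) = y2)
    by (intros; subst b11 b12 b21 b22; split; field; exact NA).
  split; [exact HB |].
  assert (Inv : forall x1 x2 y1 y2 : C,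
      (x1 = b11 * y1 + b12 * y2 /\ x2 = b21 * y1 + b22 * y2) <->
      (y1 = a11 * x1 + a12 * x2 /\ y2 = a21 * x1 + a22 * x2)).
  { intros x1 x2 y1 y2; split; intros [-> ->]; split; symmetry;
      [apply Hxy | apply Hxy | apply Hyx | apply Hyx]. }
  split; [exact Inv |].
  clear Hb11 Hb12 Hb21 Hb22 HB.
  intros x10 x20 y10 y20.
  assert (Conj : forall x1 x2,
    Fx1 x1 x2 = b11 * Fy1 (a11 * x1 + a12 * x2) (a21 * x1 + a22 * x2)
                + b12 * Fy2 (a11 * x1 + a12 * x2) (a21 * x1 + a22 * x2) /\
    Fx2 x1 x2 = b21 * Fy1 (a11 * x1 + a12 * x2) (a21 * x1 + a22 * x2)
                + b22 * Fy2 (a11 * x1 + a12 * x2) (a21 * x1 + a22 * x2)).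
  { intros x1 x2; unfold Fx1, Fx2, Fy1, Fy2; subst; split; ring. }
  clear Hc11 Hc12 Hc13 Hc21 Hc22 Hc23.
  assert (Equiv : forall (I : R -> Prop) (x1 x2 y1 y2 : R -> C), I 0%R ->
    (forall t : R, I t -> x1 t = b11 * y1 t + b12 * y2 t /\
                          x2 t = b21 * y1 t + b22 * y2 t) ->
    (solves_ivp I Fx1 Fx2 x10 x20 x1 x2 <->
     solves_ivp I Fy1 Fy2 y10 y20 y1 y2)).
  { intros I x1 x2 y1 y2 I0 E; split; intros H.
    - apply (solves_ivp_linear I Fx1 Fx2 Fy1 Fy2 a11 a12 a21 a22 x10 x20 x1 x2);
        [exact I0 | | | | exact H].
      + intros u v; destruct (Conj u v) as [-> ->]; symmetry; apply Hxy.
      + intros u v; destruct (Conj u v) as [-> ->]; symmetry; apply Hxy.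
      + intros t It; apply Inv, E, It.
    - assert (K : solves_ivp I Fx1 Fx2 (b11 * y10 + b12 * y20)
                    (b21 * y10 + b22 * y20) x1 x2).
      { apply (solves_ivp_linear I Fy1 Fy2 Fx1 Fx2 b11 b12 b21 b22 y10 y20 y1 y2);
          [exact I0 | | | exact E | exact H]; intros u v;
          destruct (Conj (b11 * u + b12 * v) (b21 * u + b22 * v)) as [C1 C2];
          destruct (Hxy u v) as [K1 K2]; rewrite K1, K2 in C1, C2; assumption. }
      destruct (Hyx x10 x20) as [E1 E2]; unfold y10, y20 in K.
      rewrite E1, E2 in K; exact K. }
  split; [intros I x1 x2 y1 y2 _; apply Equiv |].
  clearbody y10 y20.
  intros Delta HD ND Ny up um u0 d den u Y1 Y2.
  assert (N2 : RtoC 2 <> 0) by (intros e; apply RtoC_inj in e; lra).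
  split; [intros I HI I0 Nz; apply power_branch_line_exists; assumption |].
  split.
  -
    (* First make d nonzero on a symmetric interval, take the branch there, and
       then shrink the interval until den, which is Delta at 0, is nonzero. *)
    assert (Dd : forall I t, I t -> is_derive_within I d t (- y10))
      by (intros I t It; apply is_derive_within_line; exact It).
    assert (Cd := is_derive_within_continuous (fun _ => True) d 0 _ Logic.I
      (Dd _ 0%R Logic.I)).
    assert (Nd0 : d 0%R <> 0)
      by (unfold d; replace (1 - y10 * 0) with (RtoC 1) by ring; exact C1_nz).
    destruct (lim_C_neq_0 d _ Cd Nd0) as [e1 He1].
    assert (B : forall (e : R) (t : R), (Rabs t < e)%R ->
      ball (M := R_UniformSpace) 0%R e t).
    { intros e t Ht; change (Rabs (t - 0) < e)%R.
      rewrite Rminus_0_r; exact Ht. }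
    set (I1 := fun t : R => (Rabs t < e1)%R).
    assert (I10 : I1 0%R) by (unfold I1; rewrite Rabs_R0; apply cond_pos).
    destruct (power_branch_line_exists I1 y10 (- Delta)) as [p Hp].
    + intros s r t Hs Hr Ht; unfold I1 in *; revert Hs Hr; split_Rabs; lra.
    + exact I10.
    + intros t Ht; exact (He1 t (B _ t Ht) Logic.I).
    + assert (Cp := is_derive_within_continuous I1 p 0 _ I10
        (is_derive_within_power_branch I1 d (- Delta) p 0%R _ I10 Hp
          (Dd _ _ I10))).
      assert (Cden : filterlim (fun t => (u0 - um) + - (u0 - up) * p t)
        (within I1 (locally 0%R)) (locally ((u0 - um) + - (u0 - up) * p 0%R))).
      { apply lim_C_plus; [apply filterlim_const |].
        apply lim_C_mult; [apply filterlim_const | exact Cp]. }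
      destruct (lim_C_neq_0 _ _ Cden) as [e2 He2].
      * rewrite (proj1 Hp).
        replace (u0 - um + - (u0 - up) * 1) with Delta
          by (unfold up, um; field; exact N2).
        exact ND.
      * exists (Rmin e1 e2); split; [apply Rmin_glb_lt; apply cond_pos |].
        assert (S : forall t, (Rabs t < Rmin e1 e2)%R -> I1 t)
          by (intros t Ht; exact (Rlt_le_trans _ _ _ Ht (Rmin_l _ _))).
        exists p; split; [exact (is_power_branch_subset I1 _ d _ p S Hp) |].
        intros t Ht; split; [exact (He1 t (B _ t (S t Ht)) Logic.I) |].
        replace (den p t) with ((u0 - um) + - (u0 - up) * p t)
          by (unfold den; ring).
        apply He2; [| exact (S t Ht)].
        apply B, (Rlt_le_trans _ _ _ Ht (Rmin_r _ _)).
  - intros I p HI I0 Hp Nz.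
    destruct (riccati_system_formula I rho1 rho2 y10 y20 Delta p HD ND Ny I0 Hp Nz)
      as [Eu Sol].
    assert (SolY : forall y1 y2 : R -> C,
      solves_ivp I Fy1 Fy2 y10 y20 y1 y2 <->
      (forall t : R, I t -> y1 t = Y1 t /\ y2 t = Y2 p t)).
    { intros y1 y2; split; intros H.
      - exact (riccati_system_unique I rho1 rho2 y10 y20 y1 y2 _ _ HI I0 H Sol).
      - exact (solves_ivp_ext I Fy1 Fy2 y10 y20 _ _ y1 y2 I0 H Sol). }
    split; [exact Eu | split; [exact SolY |]].
    intros x1 x2.
    rewrite (Equiv I x1 x2 (fun t => a11 * x1 t + a12 * x2 t)
      (fun t => a21 * x1 t + a22 * x2 t) I0)
      by (intros t _; apply Inv; split; reflexivity).
    rewrite SolY; split; intros H t It; destruct (H t It) as [E1 E2].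
    + apply Inv; split; symmetry; assumption.
    + assert (K := proj1 (Inv _ _ _ _) (conj E1 E2)).
      split; symmetry; apply K.
Qed.
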